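(* Let $m\le n$, $S\subset[m]\times[n]$, $U\in\mathbb{R}^{m\times n}$ and $r\in[m-1]$. Then $\langle Z_{U,r}^{S}\rangle\subset H_U^{S}$, where $\langle Z_{U,r}^S\rangle$ is the linear span in $\mathbb{C}^{m\times n}$ of the set $Z_{U,r}^S$ of critical points of $d_U$ on $\mathcal{L}_r^S$, and $H_U^S$ is the critical space of $U$.
   Context: Notation: $[m]=\{1,\dots,m\}$; $\mathcal{X}_r=\{X\in\mathbb{C}^{m\times n}\mid\mathrm{rank}(X)\le r\}$, $\mathcal{L}^S=\{X=(x_{ij})\in\mathbb{C}^{m\times n}\mid x_{ij}=0\ \forall(i,j)\in S\}$, $\mathcal{L}_r^S=\mathcal{X}_r\cap\mathcal{L}^S$. Critical points: $d_U(X)=\sum_{i,j}(x_{ij}-u_{ij})^2$ on $\mathbb{C}^{m\times n}$. A critical point of $d_U$ on an algebraic variety $\mathcal{X}\subset\mathbb{C}^{m\times n}$ is a smooth point $X\in\mathcal{X}$ such that $U-X$ is orthogonal to the tangent space $T_X\mathcal{X}$ with respect to the complex bilinear form $\langle A,B\rangle_F=\mathrm{trace}(AB^T)$. $Z_{U,r}^S$ is the set of critical points of $d_U$ on $\mathcal{L}_r^S$. Critical space: put $r_U^{(i,j)}(X)=(XU^T-UX^T)_{ij}$ for $i,j\in[m]$ and $c_U^{(i,j)}(X)=(X^TU-U^TX)_{ij}$ for $i,j\in[n]$; these are linear forms in the entries of $X$. Let $M^S$ be the $m\times n$ $\{0,1\}$-matrix whose $(i,j)$ entry is $1$ exactly when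 $(i,j)\in S$. For $i,j\in[m]$ write $i\sim_R^S j$ if the $i$-th and $j$-th rows of $M^S$ coincide; for $i,j\in[n]$ write $i\sim_C^S j$ if the $i$-th and $j$-th columns of $M^S$ coincide. The critical space $H_U^S\subset\mathbb{C}^{m\times n}$ is the linear subspace of matrices $X$ on which all the linear forms $r_U^{(i,j)}$ with $i\sim_R^S j$, $c_U^{(i,j)}$ with $i\sim_C^S j$, and $x_{ij}$ with $(i,j)\in S$ vanish. *)

(* Defs.v *)
From mathcomp Require Import all_boot all_order all_algebra.
From mathcomp Require Import classical_sets reals complex mpoly.

Set Implicit Arguments.
Unset Strict Implicit.
Unset Printing Implicit Defensive.

Import GRing.Theory.

Local Open Scope classical_set_scope.
Local Open Scope ring_scope.
Local Open Scope complex_scope.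

Section AffineGeometry.
Variables (K : fieldType) (m n : nat).
Implicit Types (X V : 'M[K]_(m, n)) (Z : set 'M[K]_(m, n)).
Implicit Types (f : {mpoly K[m * n]}).

(* A polynomial function on m x n matrices is a polynomial in m * n variables,
   the entries of a matrix being numbered by [mxvec]. *)
Definition mxeval f X : K := f.@[fun k => mxvec X 0 k].

Definition mxdiff f X V : K :=
  \sum_(k < m * n) mxeval f^`M(k) X * mxvec V 0 k.

Definition zero_locus (F : set {mpoly K[m * n]}) : set 'M[K]_(m, n) :=
  [set X | forall f, F f -> mxeval f X = 0].

Definition vanishing_ideal Z : set {mpoly K[m * n]} :=
  [set f | forall X, Z X -> mxeval f X = 0].

Definition zariski_closed Z : Prop := exists F, Z = zero_locus F.

Definition zariski_irreducible Z : Prop :=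
  Z !=set0 /\
  forall A B, zariski_closed A -> zariski_closed B ->
    Z `<=` A `|` B -> Z `<=` A \/ Z `<=` B.

(* There is a chain Y 0 < Y 1 < ... < Y d of irreducible closed subsets of Z
   that all contain X. *)
Definition irreducible_chain Z X (d : nat) : Prop :=
  exists Y : nat -> set 'M[K]_(m, n),
    [/\ Y 0%N X,
        forall i, (i <= d)%N ->
          [/\ zariski_closed (Y i), zariski_irreducible (Y i) & Y i `<=` Z] &
        forall i, (i < d)%N -> Y i `<` Y i.+1].

(* Dimension of Z at X, i.e. the Krull dimension of the local ring of Z at X
   and the largest dimension of an irreducible component of Z through X;
   Z need be neither irreducible nor equidimensional. *)
Definition has_local_dimension Z X (d : nat) : Prop :=
  irreducible_chain Z X d /\ forall e, irreducible_chain Z X e -> (e <= d)%N.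

Definition tangent_space Z X : set 'M[K]_(m, n) :=
  [set V | forall f, vanishing_ideal Z f -> mxdiff f X V = 0].

Definition smooth_point Z X : Prop :=
  Z X /\
  exists T : {vspace 'M[K]_(m, n)},
    (forall V, V \in T <-> tangent_space Z X V) /\
    has_local_dimension Z X (\dim T).

Definition frobenius_form (A B : 'M[K]_(m, n)) : K := \tr (A *m B^T).

(* Critical point on Z of d_U(X) = \sum_(i, j) (x_ij - u_ij)^2, whose gradient
   at X is 2 (X - U). *)
Definition critical_point (U : 'M[K]_(m, n)) Z X : Prop :=
  smooth_point Z X /\
  forall V, tangent_space Z X V -> frobenius_form (U - X) V = 0.

Definition linear_span Z : set 'M[K]_(m, n) :=
  [set V | exists s : seq 'M[K]_(m, n),
             (forall X, X \in s -> Z X) /\ V \in <<s>>%VS].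

End AffineGeometry.

Section ZeroPattern.
Variables (K : fieldType) (m n : nat).
Implicit Types (S : {set 'I_m * 'I_n}) (U X : 'M[K]_(m, n)).

Definition rank_variety (r : nat) : set 'M[K]_(m, n) :=
  [set X | (\rank X <= r)%N].

Definition pattern_space S : set 'M[K]_(m, n) :=
  [set X | forall i j, (i, j) \in S -> X i j = 0].

Definition pattern_variety S (r : nat) : set 'M[K]_(m, n) :=
  rank_variety r `&` pattern_space S.

Definition critical_points S (r : nat) U : set 'M[K]_(m, n) :=
  [set X | critical_point U (pattern_variety S r) X].

Definition row_form U (i j : 'I_m) X : K := (X *m U^T - U *m X^T) i j.

Definition col_form U (i j : 'I_n) X : K := (X^T *m U - U^T *m X) i j.

Definition pattern_matrix S : 'M[nat]_(m, n) :=
  \matrix_(i, j) nat_of_bool ((i, j) \in S).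

Definition row_equiv S (i j : 'I_m) : Prop :=
  row i (pattern_matrix S) = row j (pattern_matrix S).

Definition col_equiv S (i j : 'I_n) : Prop :=
  col i (pattern_matrix S) = col j (pattern_matrix S).

Definition critical_space S U : set 'M[K]_(m, n) :=
  [set X | [/\ forall i j, row_equiv S i j -> row_form U i j X = 0,
               forall i j, col_equiv S i j -> col_form U i j X = 0 &
               forall i j, (i, j) \in S -> X i j = 0]].

End ZeroPattern.

Definition complexify (R : realType) (m n : nat) (U : 'M[R]_(m, n)) :
  'M[R[i]]_(m, n) := map_mx (real_complex R) U.

(* Main.v *)
Require Import Defs.
From mathcomp Require Import all_boot all_order all_algebra.
From mathcomp Require Import classical_sets reals complex mpoly.

(** Why the theorem holds.  The critical space is a linear subspace, so it is
    enough to place every critical point X in it.  If rows i and j of the zero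
    pattern agree, adding t times row j of X to row i neither raises the rank
    nor disturbs the prescribed zeros, so the whole line X + t E_ij X lies in
    the variety and its direction E_ij X is tangent at X
    ([line_direction_tangent]).  Orthogonality of U - X to this direction reads
    (U X^T)_ij = (X X^T)_ij; the same holds with i and j exchanged, and since
    X X^T is symmetric the entries (U X^T)_ij and (U X^T)_ji coincide, which is
    the vanishing of the row form.  Columns are treated in the same way with
    X E_ij in place of E_ij X.

    Tangency of a contained line is the only point where polynomials enter: the
    restriction of a polynomial f to the line is a univariate polynomial whose
    derivative at 0 is the differential of f in the direction of the line
    ([deriv_line_restriction]); if f vanishes on the variety, this restriction
    has infinitely many roots, hence is zero. *)

Set Implicit Arguments.
Unset Strict Implicit.
Unset Printing Implicit Defensive.

Import GRing.Theory Num.Theory.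

Local Open Scope classical_set_scope.
Local Open Scope ring_scope.
Local Open Scope complex_scope.

(** * Polynomials along a line *)

(** Ring morphisms and derivations are determined by their values on
    generators; this induction turns that principle into a proof method. *)
Lemma mpoly_generators_ind (K : comNzRingType) (n : nat)
    (P : {mpoly K[n]} -> Prop) :
  (forall c, P c%:MP) -> (forall i, P 'X_i) ->
  (forall f g, P f -> P g -> P (f + g)) ->
  (forall f g, P f -> P g -> P (f * g)) -> forall f, P f.
Proof.
move=> PC PX PD PM f; elim/mpolyind: f => [|c mon f _ _ Pf]; first exact: PC.
apply: PD Pf; rewrite -mul_mpolyC; apply: (PM) => //.
rewrite mpolyXE_id; apply: (big_ind P) => [|g h|k _]; [exact: PC | exact: (PM) |].
elim: (mon k) => [|e IHe]; first exact: PC.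
by rewrite exprS; apply: PM.
Qed.

Definition line_restriction (K : comNzRingType) (n : nat) (x v : 'I_n -> K)
    (f : {mpoly K[n]}) : {poly K} :=
  mmap (@polyC K) (fun k => (x k)%:P + v k *: 'X) f.

Lemma horner_line_restriction (K : comNzRingType) (n : nat) (x v : 'I_n -> K)
    (f : {mpoly K[n]}) (t : K) :
  (line_restriction x v f).[t] = f.@[fun k => x k + t * v k].
Proof.
rewrite /line_restriction; elim/mpoly_generators_ind: f.
- by move=> c; rewrite mmapC mevalC hornerC.
- by move=> i; rewrite mmapX mmap1U mevalXU !hornerE mulrC.
- by move=> f g IHf IHg; rewrite mmapD mevalD hornerD IHf IHg.
- by move=> f g IHf IHg; rewrite rmorphM mevalM hornerM IHf IHg.
Qed.

(** Chain rule: both sides are derivations of f over evaluation at x, so they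
    agree as soon as they agree on constants and variables. *)
Lemma deriv_line_restriction (K : comNzRingType) (n : nat) (x v : 'I_n -> K)
    (f : {mpoly K[n]}) :
  (line_restriction x v f)^`().[0] = \sum_(k < n) f^`M(k).@[x] * v k.
Proof.
have at0 g : (line_restriction x v g).[0] = g.@[x].
  rewrite horner_line_restriction; apply: meval_eq => k.
  by rewrite mul0r addr0.
elim/mpoly_generators_ind: f.
- move=> c; rewrite /line_restriction mmapC derivC horner0 big1 // => k _.
  by rewrite mderivC meval0 mul0r.
- move=> i; rewrite /line_restriction mmapX mmap1U derivD derivC derivZ derivX.
  rewrite !hornerE (bigD1 i) //= mderivX mnm1E eqxx -{1}[U_(i)%MM]add0m addmK mpolyX0.
  rewrite scale1r meval1 mul1r big1 ?addr0 // => k ki.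
  by rewrite mderivX mnm1E eq_sym (negPf ki) scale0r meval0 mul0r.
- move=> f g IHf IHg.
  rewrite [line_restriction _ _ _]mmapD derivD hornerD [X in X + _]IHf.
  rewrite [X in _ + X]IHg -big_split /=; apply: eq_bigr => k _.
  by rewrite mderivD mevalD mulrDl.
- move=> f g IHf IHg.
  have -> : line_restriction x v (f * g)
            = line_restriction x v f * line_restriction x v g by exact: rmorphM.
  rewrite derivM hornerD !hornerM !at0 IHf IHg.
  rewrite mulr_suml mulr_sumr -big_split /=; apply: eq_bigr => k _.
  by rewrite mderivM mevalD !mevalM mulrDl mulrA; congr (_ + _); rewrite mulrAC.
Qed.

(** In characteristic zero the natural numbers already supply more roots than
    the degree of p allows. *)
Lemma poly_eq0_everywhere (K : numFieldType) (p : {poly K}) :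
  (forall t, p.[t] = 0) -> p = 0.
Proof.
move=> p0; pose rs : seq K := [seq k%:R | k <- iota 0 (size p)].
apply: (@roots_geq_poly_eq0 _ p rs).
- by apply/allP => t _; rewrite /root p0.
- rewrite map_inj_uniq ?iota_uniq // => a b /eqP.
  by rewrite eqr_nat => /eqP.
- by rewrite size_map size_iota.
Qed.

(** * Tangent directions of the pattern variety *)

Lemma line_direction_tangent (K : numFieldType) (m n : nat)
    (Z : set 'M[K]_(m, n)) (X V : 'M[K]_(m, n)) :
  (forall t, Z (X + t *: V)) -> tangent_space Z X V.
Proof.
move=> ZXV f fZ; rewrite /mxdiff /mxeval.
rewrite -(@deriv_line_restriction _ _ (fun k => mxvec X 0 k)).
suff -> : line_restriction (fun k => mxvec X 0 k) (fun k => mxvec V 0 k) f = 0.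
  by rewrite deriv0 horner0.
apply: poly_eq0_everywhere => t; rewrite horner_line_restriction.
rewrite -[RHS](fZ _ (ZXV t)); apply: meval_eq => k.
by rewrite linearD linearZ /= !mxE.
Qed.

(** The pattern variety is stable under X |-> (1 + t E_ij) X when rows i and j
    have the same prescribed zeros. *)
Lemma row_operation_tangent (K : numFieldType) (m n r : nat)
    (S : {set 'I_m * 'I_n}) (X : 'M[K]_(m, n)) (i j : 'I_m) :
  row_equiv S i j -> pattern_variety S r X ->
  tangent_space (pattern_variety S r) X (delta_mx i j *m X).
Proof.
move=> Sij [rkX X0]; apply: line_direction_tangent => t; split.
  rewrite /rank_variety /= scalemxAl -{1}[X]mul1mx -mulmxDl.
  exact: leq_trans (mxrankM_maxr _ _) rkX.
move=> a b Sab; rewrite !mxE X0 // add0r (bigD1 j) //= mxE eqxx andbT.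
rewrite big1 ?addr0 => [|k kj]; last by rewrite mxE (negPf kj) andbF mul0r.
have [ai|_] := eqVneq a i; last by rewrite mul0r mulr0.
have /rowP/(_ b) := Sij; rewrite !mxE -ai Sab => Sjb.
by rewrite X0 ?mulr0 //; case: (_ \in S) Sjb.
Qed.

Lemma col_operation_tangent (K : numFieldType) (m n r : nat)
    (S : {set 'I_m * 'I_n}) (X : 'M[K]_(m, n)) (i j : 'I_n) :
  col_equiv S i j -> pattern_variety S r X ->
  tangent_space (pattern_variety S r) X (X *m delta_mx i j).
Proof.
move=> Sij [rkX X0]; apply: line_direction_tangent => t; split.
  rewrite /rank_variety /= scalemxAr -{1}[X]mulmx1 -mulmxDr.
  exact: leq_trans (mxrankM_maxl _ _) rkX.
move=> a b Sab; rewrite !mxE X0 // add0r (bigD1 i) //= mxE eqxx /=.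
rewrite big1 ?addr0 => [|k ki]; last by rewrite mxE (negPf ki) mulr0.
have [bj|_] := eqVneq b j; last by rewrite !mulr0.
have /colP/(_ a) := Sij; rewrite !mxE -bj Sab => Sai.
by rewrite X0 ?mul0r ?mulr0 //; case: (_ \in S) Sai.
Qed.

(** * Critical points lie in the critical space *)

Lemma mxtrace_mul_delta (K : fieldType) (m : nat) (A : 'M[K]_m) (i j : 'I_m) :
  \tr (A *m delta_mx j i) = A i j.
Proof.
(* E_ji is a column times a row; cycling the trace leaves a 1 x 1 matrix. *)
rewrite -(mul_delta_mx (0 : 'I_1)) mulmxA mxtrace_mulC mulmxA.
by rewrite -rowE -colE trace_mx11 !mxE.
Qed.

Lemma frobenius_form_row (K : fieldType) (m n : nat) (A X : 'M[K]_(m, n))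
    (i j : 'I_m) :
  frobenius_form A (delta_mx i j *m X) = (A *m X^T) i j.
Proof.
by rewrite /frobenius_form trmx_mul trmx_delta mulmxA mxtrace_mul_delta.
Qed.

Lemma frobenius_form_col (K : fieldType) (m n : nat) (A X : 'M[K]_(m, n))
    (i j : 'I_n) :
  frobenius_form A (X *m delta_mx i j) = (X^T *m A) i j.
Proof.
rewrite /frobenius_form trmx_mul trmx_delta mulmxA mxtrace_mulC mulmxA.
exact: mxtrace_mul_delta.
Qed.

Lemma critical_point_in_critical_space (K : numFieldType) (m n r : nat)
    (S : {set 'I_m * 'I_n}) (U X : 'M[K]_(m, n)) :
  critical_points S r U X -> critical_space S U X.
Proof.
move=> [[ZX _] orthX]; split; last by case: ZX.
- have UXT i j : row_equiv S i j -> (U *m X^T) i j = (X *m X^T) i j.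
    move=> Sij; have := orthX _ (row_operation_tangent Sij ZX).
    by rewrite frobenius_form_row mulmxBl !mxE => /subr0_eq.
  move=> i j Sij.
  (* Used for A = U, and for A = X to express the symmetry of X X^T. *)
  have swap A : (X *m A^T) i j = (A *m X^T) j i.
    by rewrite -[X *m _]trmxK trmx_mul trmxK mxE.
  rewrite /row_form mxE [X in _ + X]mxE swap (UXT _ _ Sij).
  by rewrite (UXT _ _ (esym Sij)) swap subrr.
- have XTU i j : col_equiv S i j -> (X^T *m U) i j = (X^T *m X) i j.
    move=> Sij; have := orthX _ (col_operation_tangent Sij ZX).
    by rewrite frobenius_form_col mulmxBr !mxE => /subr0_eq.
  move=> i j Sij.
  have swap A : (A^T *m X) i j = (X^T *m A) j i.
    by rewrite -[_ *m X]trmxK trmx_mul trmxK mxE.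
  rewrite /col_form mxE [X in _ + X]mxE swap (XTU _ _ Sij).
  by rewrite (XTU _ _ (esym Sij)) swap subrr.
Qed.

(** * The critical space is linear *)

Lemma critical_space0 (K : fieldType) (m n : nat) (S : {set 'I_m * 'I_n})
    (U : 'M[K]_(m, n)) :
  critical_space S U 0.
Proof.
by split=> i j _; rewrite /row_form /col_form ?trmx0 ?mul0mx ?mulmx0 ?subrr mxE.
Qed.

Lemma critical_spaceP (K : fieldType) (m n : nat) (S : {set 'I_m * 'I_n})
    (U X Y : 'M[K]_(m, n)) (a : K) :
  critical_space S U X -> critical_space S U Y -> critical_space S U (a *: X + Y).
Proof.
move=> [rX cX sX] [rY cY sY]; split=> i j Sij.
- have -> : row_form U i j (a *: X + Y) = a * row_form U i j X + row_form U i j Y.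
    rewrite /row_form linearP /= mulmxDl mulmxDr -scalemxAl -scalemxAr.
    by rewrite opprD addrACA -scalerBr !mxE.
  by rewrite rX // rY // mulr0 addr0.
- have -> : col_form U i j (a *: X + Y) = a * col_form U i j X + col_form U i j Y.
    rewrite /col_form linearP /= mulmxDl mulmxDr -scalemxAl -scalemxAr.
    by rewrite opprD addrACA -scalerBr !mxE.
  by rewrite cX // cY // mulr0 addr0.
- by rewrite !mxE sX // sY // mulr0 addr0.
Qed.

Lemma linear_span_sub (K : fieldType) (m n : nat) (Z P : set 'M[K]_(m, n)) :
  P 0 -> (forall a X Y, P X -> P Y -> P (a *: X + Y)) ->
  Z `<=` P -> linear_span Z `<=` P.
Proof.
move=> P0 PD ZP V [s [sZ /(@coord_span _ _ _ (in_tuple s)) ->]].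
apply: (big_rec P) => // k Y _ PY; apply: PD PY.
by apply/ZP/sZ/mem_nth.
Qed.

Theorem theorem4p3 (R : realType) (m n r : nat) (S : {set 'I_m * 'I_n})
    (U : 'M[R]_(m, n)) (hmn : (m <= n)%N) (hr : (1 <= r <= m.-1)%N) :
  linear_span (critical_points S r (complexify U))
    `<=` critical_space S (complexify U).
Proof.
apply: linear_span_sub => [|a X Y|X].
- exact: critical_space0.
- exact: critical_spaceP.
- exact: critical_point_in_critical_space.
Qed.
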